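(* Let $(G,\tau)$ and $(H,\sigma)$ be topological groups, $N$ a $\sigma$-open subgroup of $H$, $f:(G,\tau)\to(H,\sigma)$ a continuous surjective homomorphism and $s:N\to f^{-1}(N)$ a section of $f\restriction_{f^{-1}(N)}:f^{-1}(N)\to N$. For $U\in\mathcal V_{(G,\tau)}(e_G)$ and $V\in\mathcal V_{(N,\sigma\restriction_N)}(e_H)$ put $$W_s(U,V)=\{(u\,s(v),v):u\in U,\ v\in V\}\subseteq G\times N .$$ Then the family $\{W_s(U,V):U\in\mathcal V_{(G,\tau)}(e_G),\ V\in\mathcal V_{(N,\sigma\restriction_N)}(e_H)\}$ is a base of the neighborhoods of $(e_G,e_H)$ of a group topology on the direct product group $G\times N$ if and only if $s$ makes $f$ strongly A$^*$-open.
   Context: Topological groups are not assumed Hausdorff. $\mathcal V_{(G,\tau)}(e_G)$ is the filter of all neighborhoods of $e_G$ in $(G,\tau)$. For a neighborhood $U$ of $e_G$, a subset $M\subseteq G$ is $U$-thin if $\bigcap\{x^{-1}Ux:x\in M\}$ is a neighborhood of $e_G$. Write $[x,y]=xyx^{-1}y^{-1}$ and, for $g\in G$ and $K\subseteq G$, $[g,K]=\{[g,k]:k\in K\}$. A section of a surjective homomorphism $p:A\to B$ is an injective function $s:B\to A$ such that $p(s(b))=b$ for every $b\in B$ and $s(e_B)=e_A$ (no continuity required). A map $t:B\to G$ between topological groups is a quasihomomorphism if $t(e_B)=e_G$, the map $t':B\times B\to G$, $t'(b_1,b_2)=t(b_1)t(b_2)t(b_1b_2)^{-1}$, is continuous at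 $(e_B,e_B)$, and for every $y\in B$ the map $t_y:B\to G$, $t_y(b)=t(y)t(b)t(y)^{-1}t(yby^{-1})^{-1}$, is continuous at $e_B$. For $s:N\to f^{-1}(N)\subseteq G$, ''$s$ makes $f$ strongly A$^*$-open'' means: $s$ is a quasihomomorphism from $(N,\sigma\restriction_N)$ to $(G,\tau)$, and for every $U\in\mathcal V_{(G,\tau)}(e_G)$: (a) there exists $V\in\mathcal V_{(N,\sigma\restriction_N)}(e_H)$ such that $s(V)$ is $U$-thin (in $G$); (b) for every $g\in G$ there exists $V_g\in\mathcal V_{(N,\sigma\restriction_N)}(e_H)$ such that $[g,s(V_g)]\subseteq U$. *)

(* Defs.v *)
From HB Require Import structures.
From mathcomp Require Import all_boot.
From mathcomp Require Import boolp classical_sets functions topology.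

Set Implicit Arguments.
Unset Strict Implicit.
Unset Printing Implicit Defensive.

Local Open Scope classical_set_scope.
Local Open Scope group_scope.

(* No separation axiom: [topologicalType] does not include Hausdorff. *)
HB.mixin Record isTopologicalGroup G & Group G & Topological G := {
  mulg_continuous : continuous (fun xy : G * G => xy.1 * xy.2 : G);
  invg_continuous : continuous (fun x : G => x^-1 : G)
}.

#[short(type="topologicalGroupType")]
HB.structure Definition TopologicalGroup :=
  {G of Group G & Topological G & isTopologicalGroup G}.

(* A topology on the carrier of a group [X] is given as a [Topological]
   structure [t] on it; it is independent of any topology that canonical
   structure inference would find on [X] (such as a product topology). *)
Definition group_topology (X : groupType) (t : Topological.axioms_ X) : Prop :=
  let T : topologicalType := Topological.Pack t in
  continuous (fun xy : T * T => (xy.1 : X) * (xy.2 : X) : T) /\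
  continuous (fun x : T => (x : X)^-1 : T).

Definition nbhs_base (T : topologicalType) (x : T) (B : set (set T)) : Prop :=
  B `<=` nbhs x /\ forall A, nbhs x A -> exists2 W, B W & W `<=` A.

Definition nbhs_base_of_group_topology (X : groupType) (B : set (set X)) :
    Prop :=
  exists t : Topological.axioms_ X,
    group_topology t /\ @nbhs_base (Topological.Pack t) (1 : X) B.

(* The subgroup [N] as a type, with the topology induced by the inclusion
   when the ambient group is topological. *)
Definition subgroup_of (H : groupType) (N : groupClosed H) : Type :=
  set_type [set` N].

Section SubgroupOf.
Variables (H : groupType) (N : groupClosed H).

Lemma in_subgroup_of (x : H) : (x \in [set` N]) = (x \in N).
Proof. by apply/idP/idP => [/set_mem|/mem_set]. Qed.

Lemma subgroup_of_closed : group_closed (fun x => x \in [set` N]).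
Proof.
split=> [|x y]; rewrite -!topredE /= !in_subgroup_of; first exact: gpred1.
exact: gpredF.
Qed.

HB.instance Definition _ := SubChoice.copy (subgroup_of N) (set_type [set` N]).
HB.instance Definition _ := SubChoice_isSubGroup.Build
  H (fun x => x \in [set` N]) (subgroup_of N) subgroup_of_closed.

End SubgroupOf.

HB.instance Definition _ (H : topologicalGroupType) (N : groupClosed H) :=
  Topological.copy (subgroup_of N) (set_type [set` N]).

Section SubgroupOfTopology.
Variables (H : topologicalGroupType) (N : groupClosed H).

Let val_continuous : continuous (val : subgroup_of N -> H).
Proof. exact: (@initial_continuous (set_type [set` N]) H set_val). Qed.

Let continuous_val (T : topologicalType) (f : T -> subgroup_of N) :
  continuous (val \o f) -> continuous f.
Proof.
by move=> cf; exact/(@continuous_comp_initial (set_type [set` N]) T H set_val).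
Qed.

Lemma subgroup_of_mulg_continuous :
  continuous (fun xy : subgroup_of N * subgroup_of N => xy.1 * xy.2).
Proof.
apply: continuous_val => -[x y].
apply: (@cvg_comp _ _ _ (fun xy : subgroup_of N * subgroup_of N =>
    (val xy.1, val xy.2)) (fun xy : H * H => xy.1 * xy.2)
    _ (nbhs (val x, val y))); last exact: (mulg_continuous (val x, val y)).
apply: cvg_pair.
  by apply: (@cvg_comp _ _ _ fst val); [exact: cvg_fst|exact: val_continuous].
by apply: (@cvg_comp _ _ _ snd val); [exact: cvg_snd|exact: val_continuous].
Qed.

Lemma subgroup_of_invg_continuous :
  continuous (fun x : subgroup_of N => x^-1).
Proof.
apply: continuous_val => x.
apply: (@cvg_comp _ _ _ val (fun y : H => y^-1)).
  exact: val_continuous.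
exact: (invg_continuous (val x)).
Qed.

HB.instance Definition _ := isTopologicalGroup.Build (subgroup_of N)
  subgroup_of_mulg_continuous subgroup_of_invg_continuous.

End SubgroupOfTopology.

Section PreimageSubgroup.
Variables (G H : groupType) (f : UMagmaMorphism.type G H) (N : groupClosed H).

Definition preim_subgroup : {pred G} := [pred x | f x \in N].

Lemma preim_subgroupM : mulg_closed preim_subgroup.
Proof. by move=> x y; rewrite !inE => fx fy; rewrite gmulfM gpredM. Qed.
Lemma preim_subgroup1 : 1 \in preim_subgroup.
Proof. by rewrite inE gmulf1 gpred1. Qed.
Lemma preim_subgroupV : invg_closed preim_subgroup.
Proof. by move=> x; rewrite !inE => fx; rewrite gmulfV gpredV. Qed.

HB.instance Definition _ := isMulClosed.Build G preim_subgroup preim_subgroupM.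
HB.instance Definition _ := isMul1Closed.Build G preim_subgroup preim_subgroup1.
HB.instance Definition _ := isInvClosed.Build G preim_subgroup preim_subgroupV.

Lemma preim_restr_subproof (x : subgroup_of preim_subgroup) :
  f (val x) \in [set` N].
Proof. by have := valP x; rewrite !in_subgroup_of. Qed.

Definition preim_restr (x : subgroup_of preim_subgroup) : subgroup_of N :=
  Sub (f (val x)) (preim_restr_subproof x).

Lemma preim_restrM : {morph preim_restr : x y / x * y}.
Proof. by move=> x y; apply: val_inj; rewrite /= gmulfM. Qed.

Lemma preim_restr1 : preim_restr 1 = 1.
Proof. by apply: val_inj; rewrite /= gmulf1. Qed.

HB.instance Definition _ := isUMagmaMorphism.Build _ _ preim_restr
  (preim_restr1, preim_restrM).

End PreimageSubgroup.

Arguments preim_restr {G H} f N x.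

Definition is_section (A B : groupType) (p : UMagmaMorphism.type A B)
    (s : B -> A) : Prop :=
  [/\ injective s, forall b, p (s b) = b & s 1 = 1].

Definition quasihomomorphism (B G : topologicalGroupType) (t : B -> G) : Prop :=
  [/\ t 1 = 1,
      {for (1, 1) : B * B, continuous (fun b : B * B =>
         t b.1 * t b.2 * (t (b.1 * b.2))^-1)}
    & forall y : B, {for 1, continuous (fun b : B =>
         t y * t b * (t y)^-1 * (t (y * b * y^-1))^-1)}].

Definition thin (G : topologicalGroupType) (U M : set G) : Prop :=
  nbhs 1 (\bigcap_(x in M) [set x^-1 * u * x | u in U]).

(* Not the commutator [~ x, y] = x^-1 * y^-1 * x * y of the library. *)
Definition commutator (G : groupType) (x y : G) : G := x * y * x^-1 * y^-1.

Section StronglyAstarOpen.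
Variables (G H : topologicalGroupType) (f : UMagmaMorphism.type G H).
Variables (N : groupClosed H).
Variable s : subgroup_of N -> subgroup_of (preim_subgroup f N).

Let sG (v : subgroup_of N) : G := val (s v).

Definition strongly_Astar_open : Prop :=
  quasihomomorphism sG /\
  forall U : set G, nbhs 1 U ->
    (exists2 V : set (subgroup_of N), nbhs 1 V & thin U (sG @` V)) /\
    (forall g : G, exists2 V : set (subgroup_of N),
       nbhs 1 V & [set commutator g k | k in sG @` V] `<=` U).

Definition Wset (U : set G) (V : set (subgroup_of N)) :
    set (G * subgroup_of N) :=
  [set (u * sG v, v) | u in U & v in V].

Definition Wfamily : set (set (G * subgroup_of N)) :=
  [set Wset U V | U in nbhs (1 : G) & V in nbhs (1 : subgroup_of N)].

End StronglyAstarOpen.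

(* Main.v *)
Require Import Defs.
From HB Require Import structures.
From mathcomp Require Import all_boot.
From mathcomp Require Import boolp classical_sets functions topology.

(** Write [t v] for the value in [G] of the section at [v]. A point [(g, v)]
    lies in the basic set attached to [(U, V)] exactly when [g * (t v)^-1]
    is in [U] and [v] is in [V]: these sets are neighborhoods of the graph of
    [t] above [V], thickened by [U] on the left.

    A family of sets is a base at the identity of some group topology as soon
    as it is a filter base of sets containing the identity for which
    multiplication and inversion are continuous at the identity, as is
    conjugation by each fixed element; this is [nbhs_base_of_group_topologyP].
    It remains to read these conditions on thickened graphs.

    Necessity ([strongly_Astar_map_of_base]) comes from testing continuity on
    well-chosen points. The product of the graph points [(t v, v)] and
    [(t w, w)] gives the multiplicative defect [t v * t w * (t (v * w))^-1];
    conjugating [(t v, v)] by [(t y, y)] gives the conjugation defect, and by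
    [(g, 1)] the commutator of [g] and [t v]; the product of [(t v, v)] and
    [(u, 1)] gives the conjugate of [u] by [t v], whence thinness.

    Sufficiency ([base_of_strongly_Astar_map]) expresses the [G]-coordinate of
    a product, inverse or conjugate of thickened graph points, corrected by
    [t] of its second coordinate, as a product of factors each of which is
    small by one of the hypotheses:
    - product: [u1], then the conjugate of [u2] by [t v1] (thinness), then the
      multiplicative defect of [(v1, v2)];
    - inverse: the inverse of the multiplicative defect of [(v^-1, v)], then
      the conjugate of [u^-1] by [t v^-1] (thinness);
    - conjugate by [(g, y)]: the conjugate of [u] by [g], then the commutator
      of [g] and [t v], then the inverse of the commutator of [t y] and [t v],
      then the conjugation defect of [t] at [y]. *)

Set Implicit Arguments.
Unset Strict Implicit.
Unset Printing Implicit Defensive.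

Local Open Scope classical_set_scope.
Local Open Scope group_scope.

(** * Neighborhood bases of the identity *)

(** The classical criterion for a family to be a base at the identity of a
    group topology. *)
Record group_filter_base (X : groupType) (B : set (set X)) : Prop := {
  gfb_nonempty : B !=set0;
  gfb_setI : forall W1 W2, B W1 -> B W2 -> exists2 W, B W & W `<=` W1 `&` W2;
  gfb_one : forall W, B W -> W 1;
  gfb_mul : forall W, B W ->
    exists2 W', B W' & forall x y, W' x -> W' y -> W (x * y);
  gfb_inv : forall W, B W -> exists2 W', B W' & forall x, W' x -> W x^-1;
  gfb_conj : forall g W, B W ->
    exists2 W', B W' & forall x, W' x -> W (g * x * g^-1)
}.

(** A copy of the carrier of [X], indexed by the proof so that the topology it
    carries cannot clash with one that inference finds on [X] itself, such as
    a product topology. *)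
Definition translate_topology (X : groupType) (B : set (set X))
  (hB : group_filter_base B) : Type := X.

Section TranslateTopology.
Variables (X : groupType) (B : set (set X)) (hB : group_filter_base B).
Local Notation T := (translate_topology hB).

Definition translate_nbhs (p : X) : set (set X) :=
  [set A | exists2 W, B W & forall x, W x -> A (p * x)].

HB.instance Definition _ := Choice.copy T X.
HB.instance Definition _ := hasNbhs.Build T translate_nbhs.

Lemma translate_nbhs_filter (p : T) : ProperFilter (nbhs p).
Proof.
split.
  by move=> [W BW W0]; exact: (W0 _ (gfb_one hB BW)).
split.
- by have [W BW] := gfb_nonempty hB; exists W.
- move=> P Q [W1 BW1 W1P] [W2 BW2 W2Q].
  have [W BW WW] := gfb_setI hB BW1 BW2; exists W => // x /WW[? ?].
  by split; [exact: W1P|exact: W2Q].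
- by move=> P Q PQ [W BW WP]; exists W => // x /WP/PQ.
Qed.

Lemma translate_nbhs_singleton (p : T) (A : set T) : nbhs p A -> A p.
Proof.
by move=> [W BW WA]; have := WA _ (gfb_one hB BW); rewrite mulg1.
Qed.

(** If [W' * W'] is contained in [W], then each point of [p * W'] has
    [p * W] as a neighborhood. *)
Lemma translate_nbhs_nbhs (p : T) (A : set T) : nbhs p A -> nbhs p (nbhs^~ A).
Proof.
move=> [W BW WA]; have [W' BW' W'W] := gfb_mul hB BW.
exists W' => // x W'x; exists W' => // y W'y.
by rewrite -mulgA; apply: WA; exact: W'W.
Qed.

HB.instance Definition _ := Nbhs_isNbhsTopological.Build T
  translate_nbhs_filter translate_nbhs_singleton translate_nbhs_nbhs.

(** Left translates are used at every point, so the perturbation of the left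
    factor must be moved across [y]:
    [x * a * (y * b) = x * y * (y^-1 * a * y * b)]. *)
Lemma translate_mulg_continuous :
  continuous (fun xy : T * T => (xy.1 : X) * (xy.2 : X) : T).
Proof.
move=> [x y] A [W BW WA].
have [W1 BW1 W1W] := gfb_mul hB BW.
have [W2 BW2 W2W] := gfb_conj hB (y : X)^-1 BW1.
exists ([set (x : X) * a | a in W2] , [set (y : X) * b | b in W1]) => /=.
  by split; [exists W2|exists W1] => // z Wz; exists z.
move=> [_ _] [/= [a W2a <-] [b W1b <-]].
have /= := WA _ (W1W _ _ (W2W _ W2a) W1b).
by rewrite invgK !mulgA mulgK.
Qed.

(** [(x * a)^-1 = x^-1 * (x * a^-1 * x^-1)]. *)
Lemma translate_invg_continuous : continuous (fun x : T => (x : X)^-1 : T).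
Proof.
move=> x A [W BW WA].
have [W1 BW1 W1W] := gfb_conj hB (x : X) BW.
have [W2 BW2 W2W] := gfb_inv hB BW1.
exists W2 => // a W2a /=; have := WA _ (W1W _ (W2W _ W2a)).
by rewrite !mulgA mulVg mul1g invgM.
Qed.

Lemma translate_group_topology :
  group_topology (Topological.class T : Topological.axioms_ X).
Proof.
by split; [exact: translate_mulg_continuous|exact: translate_invg_continuous].
Qed.

End TranslateTopology.

(** In one direction, the conditions are continuity of the operations at the
    identity read on the base; in the other, the translates of the base define
    the topology. *)
Lemma nbhs_base_of_group_topologyP (X : groupType) (B : set (set X)) :
  nbhs_base_of_group_topology B <-> group_filter_base B.
Proof.
split=> [[t [[cM cV] [Bnbhs nbhsB]]]|hB]; last first.
  exists (Topological.class (translate_topology hB)).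
  split; first exact: translate_group_topology.
  split=> [W BW|A [W BW WA]].
    by exists W => // x; rewrite mul1g.
  by exists W => // x /WA; rewrite mul1g.
set T := Topological.Pack t in cM cV Bnbhs nbhsB.
have cMl (g : T) : continuous (fun y : T => (g : X) * (y : X) : T).
  move=> x.
  apply: (@cvg_comp _ _ _ (fun y : T => (g, y))
    (fun xy : T * T => (xy.1 : X) * (xy.2 : X) : T) _ (nbhs (g, x)));
    last exact: (cM (g, x)).
  by apply: cvg_pair; [exact: cvg_cst|exact: cvg_id].
have cMr (g : T) : continuous (fun y : T => (y : X) * (g : X) : T).
  move=> x.
  apply: (@cvg_comp _ _ _ (fun y : T => (y, g))
    (fun xy : T * T => (xy.1 : X) * (xy.2 : X) : T) _ (nbhs (x, g)));
    last exact: (cM (x, g)).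
  by apply: cvg_pair; [exact: cvg_id|exact: cvg_cst].
split.
- by have [W BW _] := nbhsB _ (@filterT _ (nbhs ((1 : X) : T)) _); exists W.
- by move=> W1 W2 /Bnbhs nW1 /Bnbhs nW2; exact/nbhsB/filterI.
- by move=> W /Bnbhs; exact: nbhs_singleton.
- move=> W /Bnbhs nW.
  have := cM (1 : X, 1 : X); rewrite /continuous_at /= mulg1 => /(_ _ nW).
  move=> [[P Q] [/= nP nQ] PQ].
  have [W' BW' W'PQ] := nbhsB _ (filterI nP nQ).
  by exists W' => // x y /W'PQ[Px _] /W'PQ[_ Qy]; exact: (PQ (x, y)).
- move=> W /Bnbhs nW.
  have := cV (1 : X); rewrite /continuous_at /= invg1 => /(_ _ nW) nV.
  by have [W' BW' W'V] := nbhsB _ nV; exists W'.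
- move=> g W /Bnbhs nW.
  (* Conjugation by [g] is a left translation followed by a right one. *)
  have nV : nbhs (g : T) [set y : T | W ((y : X) * g^-1)].
    by apply: (cMr g^-1 g); rewrite /= mulgV.
  have nV' : nbhs ((1 : X) : T) [set y : T | W (g * (y : X) * g^-1)].
    by have := cMl g (1 : X); rewrite /continuous_at mulg1 => /(_ _ nV).
  by have [W' BW' W'V] := nbhsB _ nV'; exists W'.
Qed.

Lemma nbhs1_group_filter_base (G : topologicalGroupType) :
  group_filter_base (nbhs (1 : G)).
Proof.
apply/nbhs_base_of_group_topologyP.
exists (Topological.class G); split.
  by split; [exact: mulg_continuous|exact: invg_continuous].
by split=> // A nA; exists A.
Qed.

(** * Thickened graphs of a map between topological groups *)

Section ThickenedGraph.
Variables (B G : topologicalGroupType) (t : B -> G).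

Definition thick_graph (U : set G) (V : set B) : set (G * B) :=
  [set (u * t v, v) | u in U & v in V].

Definition thick_graphs : set (set (G * B)) :=
  [set thick_graph U V | U in nbhs (1 : G) & V in nbhs (1 : B)].

Lemma thick_graphP U V g b : thick_graph U V (g, b) <-> U (g * (t b)^-1) /\ V b.
Proof.
split=> [[u Uu [v Vv [<- <-]]]|[Ug Vb]]; first by rewrite mulgK.
by exists (g * (t b)^-1) => //; exists b; rewrite // mulgVK.
Qed.

Definition strongly_Astar_map : Prop :=
  quasihomomorphism t /\
  forall U : set G, nbhs 1 U ->
    (exists2 V : set B, nbhs 1 V & thin U (t @` V)) /\
    (forall g : G, exists2 V : set B,
       nbhs 1 V & [set commutator g k | k in t @` V] `<=` U).

Hypothesis t1 : t 1 = 1.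

Lemma mem_thick_graphs U V : nbhs (1 : G) U -> nbhs (1 : B) V ->
  thick_graphs (thick_graph U V).
Proof. by move=> nU nV; exists U => //; exists V. Qed.

Lemma graph_sub U V v : nbhs (1 : G) U -> V v -> thick_graph U V (t v, v).
Proof.
move=> nU Vv; apply/thick_graphP; rewrite mulgV; split=> //.
exact: nbhs_singleton.
Qed.

(** Throughout, the target set is [U] thickened over the whole of [B], so that
    only the condition on the [G]-coordinate remains. *)
Lemma strongly_Astar_map_of_base :
  group_filter_base thick_graphs -> strongly_Astar_map.
Proof.
move=> hB; split; first split=> //.
- move=> U; rewrite /= !mulg1 t1 mulg1 mulgV => nU.
  have [_ [U1 nU1 [V1 nV1 <-]] W1W] :=
    gfb_mul hB (mem_thick_graphs nU (@filterT _ (nbhs (1 : B)) _)).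
  exists (V1, V1) => //= -[b1 b2] /= [V1b1 V1b2].
  by have /thick_graphP[] := W1W _ _ (graph_sub nU1 V1b1) (graph_sub nU1 V1b2).
- move=> y U; rewrite /= t1 !mulg1 mulgV mulgV t1 invg1 mulg1 => nU.
  have [_ [U1 nU1 [V1 nV1 <-]] W1W] := gfb_conj hB (t y, y)
    (mem_thick_graphs nU (@filterT _ (nbhs (1 : B)) _)).
  apply: (filterS _ nV1) => b V1b /=.
  by have /thick_graphP[] := W1W _ (graph_sub nU1 V1b).
- move=> U nU; split.
    have [_ [U1 nU1 [V1 nV1 <-]] W1W] :=
      gfb_mul hB (mem_thick_graphs nU (@filterT _ (nbhs (1 : B)) _)).
    exists V1 => //; apply: (filterS _ nU1) => u U1u _ [v V1v <-] /=.
    have u1 : thick_graph U1 V1 (u, 1).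
      apply/thick_graphP; rewrite t1 invg1 mulg1.
      by split=> //; exact: nbhs_singleton.
    have /thick_graphP[/= + _] := W1W _ _ (graph_sub nU1 V1v) u1.
    rewrite mulg1 => Uu; exists (t v * u * (t v)^-1) => //.
    by rewrite !mulgA mulVg mul1g mulgVK.
  move=> g.
  have [_ [U1 nU1 [V1 nV1 <-]] W1W] := gfb_conj hB (g, 1)
    (mem_thick_graphs nU (@filterT _ (nbhs (1 : B)) _)).
  exists V1 => // _ [_ [v V1v <-] <-].
  have /thick_graphP[/= + _] := W1W _ (graph_sub nU1 V1v).
  by rewrite mul1g invg1 mulg1.
Qed.

(** Each of the last three conditions follows from one factorization in [G],
    the number of factors dictating how often [U] has to be divided. *)
Lemma base_of_strongly_Astar_map :
  strongly_Astar_map -> group_filter_base thick_graphs.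
Proof.
move=> [[_ quasiM quasiJ] thin_comm].
have GB := nbhs1_group_filter_base G; have BB := nbhs1_group_filter_base B.
have thin_conj U : nbhs 1 U -> exists2 U', nbhs 1 U' &
    exists2 V, nbhs 1 V & forall u v, U' u -> V v -> U (t v * u * (t v)^-1).
  move=> /thin_comm[[V nV thinU] _].
  exists (\bigcap_(x in t @` V) [set x^-1 * u * x | u in U]) => //.
  exists V => // u v + Vv => /(_ (t v)) [|w Uw <-]; first by exists v.
  by rewrite !mulgA mulgV mul1g mulgK.
have defectM U : nbhs 1 U -> exists2 V, nbhs 1 V &
    forall v w, V v -> V w -> U (t v * t w * (t (v * w))^-1).
  move=> nU; have := quasiM U; rewrite /= !mulg1 t1 mulg1 mulgV.
  move=> /(_ nU)[[P Q] [/= nP nQ] PQ]; exists (P `&` Q); first exact: filterI.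
  by move=> v w [Pv _] [_ Qw]; exact: (PQ (v, w)).
have defectJ U y : nbhs 1 U -> exists2 V, nbhs 1 V & forall v, V v ->
    U (t y * t v * (t y)^-1 * (t (y * v * y^-1))^-1).
  move=> nU; have := quasiJ y U.
  rewrite /= t1 !mulg1 mulgV mulgV t1 invg1 mulg1.
  move=> /(_ nU) nV.
  by exists (fun v => U (t y * t v * (t y)^-1 * (t (y * v * y^-1))^-1)).
have comm U g : nbhs 1 U -> exists2 V, nbhs 1 V & forall v, V v ->
    U (g * t v * g^-1 * (t v)^-1).
  move=> /thin_comm[_ /(_ g)[V nV VU]]; exists V => // v Vv; apply: VU.
  by exists (t v) => //; exists v.
split.
- by exists (thick_graph setT setT); apply: mem_thick_graphs; exact: filterT.
- move=> _ _ [U1 nU1 [V1 nV1 <-]] [U2 nU2 [V2 nV2 <-]].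
  exists (thick_graph (U1 `&` U2) (V1 `&` V2)).
    by apply: mem_thick_graphs; exact: filterI.
  by move=> [g b] /thick_graphP[[? ?] [? ?]]; split; apply/thick_graphP.
- move=> _ [U nU [V nV <-]]; apply/thick_graphP => /=.
  by rewrite t1 invg1 mulg1; split; exact: nbhs_singleton.
- move=> _ [U nU [V nV <-]].
  have [U1 nU1 U1U] := gfb_mul GB nU.
  have [U2 nU2 U2U1] := gfb_mul GB nU1.
  have [U3 nU3 [V3 nV3 thinU3]] := thin_conj _ nU2.
  have [V4 nV4 V4U2] := defectM _ nU2.
  have [V5 nV5 V5V] := gfb_mul BB nV.
  exists (thick_graph (U1 `&` U3) (V3 `&` V4 `&` V5)).
    by apply: mem_thick_graphs; do !apply: filterI.
  move=> _ w [u1 [U1u1 _] [v1 [[V3v1 V4v1] V5v1] <-]].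
  move=> [u2 [_ U3u2] [v2 [[_ V4v2] V5v2] <-]].
  apply/thick_graphP; split; last exact: V5V.
  have -> : u1 * t v1 * (u2 * t v2) * (t (v1 * v2))^-1 =
      u1 * (t v1 * u2 * (t v1)^-1 * (t v1 * t v2 * (t (v1 * v2))^-1)).
    by rewrite !mulgA mulgVK.
  apply: U1U => //; apply: U2U1; first exact: thinU3.
  exact: V4U2.
- move=> _ [U nU [V nV <-]].
  have [U1 nU1 U1U] := gfb_mul GB nU.
  have [U2 nU2 U2U1] := gfb_inv GB nU1.
  have [U3 nU3 [V3 nV3 thinU3]] := thin_conj _ nU1.
  have [U4 nU4 U4U3] := gfb_inv GB nU3.
  have [V4 nV4 V4U2] := defectM _ nU2.
  have [V5 nV5 V5V] := gfb_inv BB (filterI (filterI nV3 nV4) nV).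
  exists (thick_graph U4 (V4 `&` V5)).
    by apply: mem_thick_graphs => //; exact: filterI.
  move=> _ [u U4u [v [V4v V5v] <-]].
  have [[V3v V4v'] Vv] := V5V _ V5v.
  apply/thick_graphP; split=> //=.
  have -> : (u * t v)^-1 * (t v^-1)^-1 =
      (t v^-1 * t v * (t (v^-1 * v))^-1)^-1 * (t v^-1 * u^-1 * (t v^-1)^-1).
    by rewrite mulVg t1 invg1 mulg1 !invgM !mulgA mulgVK.
  apply: U1U; first by apply: U2U1; exact: V4U2.
  by apply: thinU3 => //; exact: U4U3.
- move=> [g y] _ [U nU [V nV <-]].
  have [U1 nU1 U1U] := gfb_mul GB nU.
  have [U2 nU2 U2U1] := gfb_mul GB nU1.
  have [U3 nU3 U3U2] := gfb_mul GB nU2.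
  have [U4 nU4 U4U3] := gfb_inv GB nU3.
  have [U5 nU5 U5U1] := gfb_conj GB g nU1.
  have [V1 nV1 V1U2] := comm _ g nU2.
  have [V2 nV2 V2U4] := comm _ (t y) nU4.
  have [V3 nV3 V3U3] := defectJ _ y nU3.
  have [V4 nV4 V4V] := gfb_conj BB y nV.
  exists (thick_graph U5 (V1 `&` V2 `&` V3 `&` V4)).
    by apply: mem_thick_graphs => //; do !apply: filterI.
  move=> _ [u U5u [v [[[V1v V2v] V3v] V4v] <-]].
  apply/thick_graphP; split; last exact: V4V.
  have -> : g * (u * t v) * g^-1 * (t (y * v * y^-1))^-1 =
      g * u * g^-1 * (g * t v * g^-1 * (t v)^-1 *
        ((t y * t v * (t y)^-1 * (t v)^-1)^-1 *
         (t y * t v * (t y)^-1 * (t (y * v * y^-1))^-1))).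
    by rewrite !invgM !invgK !mulgA !mulgVK mulgK.
  apply: U1U; first exact: U5U1.
  apply: U2U1; first exact: V1U2.
  apply: U3U2; last exact: V3U3.
  by apply: U4U3; exact: V2U4.
Qed.

End ThickenedGraph.

Theorem theorem4p20 (G H : topologicalGroupType) (N : groupClosed H)
    (N_open : open [set` N])
    (f : UMagmaMorphism.type G H) (f_continuous : continuous f)
    (f_surjective : set_surj [set: G] [set: H] f)
    (s : subgroup_of N -> subgroup_of (preim_subgroup f N))
    (s_section : is_section (preim_restr f N) s) :
  nbhs_base_of_group_topology (Wfamily s) <-> strongly_Astar_open s.
Proof.
have t1 : val (s 1) = 1 by case: s_section => _ _ ->.
split=> [/nbhs_base_of_group_topologyP hB|hs].
  exact: strongly_Astar_map_of_base.
apply/nbhs_base_of_group_topologyP; exact: base_of_strongly_Astar_map.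
Qed.
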